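(* Let $d\in\mathbb{N}$ and $\alpha\in(0,1]$. There is a constant $c=c(d,\alpha)>0$ such that the following holds for every $n\in\mathbb{N}$. Let $J$ be a real symmetric $n\times n$ matrix with $J_{ii}=0$ and $\max_i\sum_j|J_{ij}|\le1-\alpha$, and let $q^n$ be the probability measure on $\{-1,+1\}^n$ proportional to $\exp\big(\tfrac12\sum_{i,j}J_{ij}\sigma_i\sigma_j\big)$ (no external field). For any family of real coefficients $a=(a_I)_{I\subset\{1,\ldots,n\},\,|I|=d}$, the $d$-homogeneous polynomial $f(\sigma)=\sum_{|I|=d}a_I\prod_{i\in I}\sigma_i$ satisfies for all $t>0$ \[ q^n(|f-\mathbb{E}_{q^n}f|\ge t)\le 2\exp\Big(-\frac{t^{2/d}}{c\,n\,\|a\|_\infty^{2/d}}\Big), \] where $\|a\|_\infty=\max_{|I|=d}|a_I|$. *)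

(* Defs.v *)
From HB Require Import structures.
From mathcomp Require Import all_boot all_order all_algebra.
From mathcomp Require Import all_classical all_reals all_analysis.
Set Implicit Arguments. Unset Strict Implicit. Unset Printing Implicit Defensive.
Import Order.TTheory GRing.Theory Num.Theory.
Local Open Scope ring_scope.

Section Ising.
Variables (R : realType) (n : nat).

Definition config := {ffun 'I_n -> bool}.
Definition spin (s : config) (i : 'I_n) : R := if s i then 1 else -1.

Definition gibbs_weight (J : 'M[R]_n) (s : config) : R :=
  expR (2^-1 * \sum_(i < n) \sum_(j < n) J i j * spin s i * spin s j).

Definition partition_fn (J : 'M[R]_n) : R := \sum_(s : config) gibbs_weight J s.
Definition gibbs (J : 'M[R]_n) (s : config) : R :=
  gibbs_weight J s / partition_fn J.

Definition gibbs_prob (J : 'M[R]_n) (E : pred config) : R :=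
  \sum_(s : config | E s) gibbs J s.
Definition gibbs_exp (J : 'M[R]_n) (f : config -> R) : R :=
  \sum_(s : config) gibbs J s * f s.

Definition hom_poly (d : nat) (a : {set 'I_n} -> R) (s : config) : R :=
  \sum_(I : {set 'I_n} | #|I| == d) a I * \prod_(i in I) spin s i.

Definition coef_sup (d : nat) (a : {set 'I_n} -> R) : R :=
  \big[Num.max/0]_(I : {set 'I_n} | #|I| == d) `|a I|.

End Ising.

(* Main.v *)
Require Import Defs.
From HB Require Import structures.
From mathcomp Require Import all_boot all_order all_algebra.
From mathcomp Require Import all_classical all_reals all_analysis.
From mathcomp Require Import ring lra.
Import Order.TTheory GRing.Theory Num.Theory.
Local Open Scope ring_scope.

(** By Ginibre's duplication argument, if the Walsh coefficients of [g] dominate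
    those of [f] in absolute value, then the expectation of [f] under the couplings
    [J] is at most that of [g] under the couplings [|J|].  Writing [M] for the sum of
    the spins, the coefficients of [f] are dominated by those of [||a|| M^d], so
    [E_J f^(2k) <= ||a||^(2k) E_|J| M^(2dk)].  For ferromagnetic couplings,
    [u cosh u - sinh u] has nonnegative Taylor coefficients, which gives the mean-field
    bound [E s_i g <= E u_i g] with [u_i] the local field at [i] and [g] not depending
    on [s_i].  Summing over [i] yields [alpha E M^(p+1) <= n p E M^(p-1)], hence the
    Gaussian moment bound [E M^(2m) <= (2 m n / alpha)^m].  Markov's inequality with
    the optimal [k] concludes. *)

(** * Hyperbolic functions *)

Section Cone.
Context {R : realType} {n : nat}.
Implicit Types (f g u : config n -> R) (s r : config n) (k l : 'I_n -> nat).

Definition cosh (x : R) : R := (expR x + expR (- x)) / 2.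
Definition sinh (x : R) : R := (expR x - expR (- x)) / 2.

Lemma expR_cosh_sinh x : expR x = cosh x + sinh x.
Proof. by rewrite /cosh /sinh; field. Qed.

Lemma coshD x y : cosh (x + y) = cosh x * cosh y + sinh x * sinh y.
Proof. by rewrite /cosh /sinh opprD !expRD; field. Qed.

Lemma sinhD x y : sinh (x + y) = sinh x * cosh y + cosh x * sinh y.
Proof. by rewrite /cosh /sinh opprD !expRD; field. Qed.

Lemma cosh0 : cosh 0 = 1.
Proof. by rewrite /cosh oppr0 expR0; field. Qed.

Lemma sinh0 : sinh 0 = 0.
Proof. by rewrite /sinh oppr0 subrr mul0r. Qed.

Lemma cosh_ge0 x : 0 <= cosh x.
Proof. by rewrite divr_ge0 // addr_ge0 ?expR_ge0. Qed.

Lemma sinh_ge0 x : 0 <= x -> 0 <= sinh x.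
Proof.
by move=> x0; rewrite divr_ge0 // subr_ge0 ler_expR; lra.
Qed.

Lemma cosh_sign x e : e ^+ 2 = 1 -> cosh (x * e) = cosh x.
Proof.
move/eqP; rewrite sqrf_eq1 => /orP[]/eqP->; rewrite ?mulr1 // mulrN1 /cosh opprK.
by rewrite addrC.
Qed.

Lemma sinh_sign x e : e ^+ 2 = 1 -> sinh (x * e) = sinh x * e.
Proof.
move/eqP; rewrite sqrf_eq1 => /orP[]/eqP->; rewrite ?mulr1 // !mulrN1 /sinh opprK.
by rewrite -mulNr opprB.
Qed.

(** * Spins, Walsh monomials and the cone they generate *)

Lemma spin_sqr s i : spin R s i ^+ 2 = 1.
Proof. by rewrite /spin; case: (s i); rewrite ?sqrrN expr1n. Qed.

(* Exponents in [nat] are redundant, since spins square to [1], but make products of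
   monomials plain exponent addition. *)
Definition monomial k s : R := \prod_i spin R s i ^+ k i.

Lemma monomial_sqr k s : monomial k s ^+ 2 = 1.
Proof.
rewrite -prodrXl big1 // => i _.
by rewrite -exprM mulnC exprM spin_sqr expr1n.
Qed.

Lemma monomialM k l s :
  monomial k s * monomial l s = monomial (fun i => k i + l i)%N s.
Proof. by rewrite -big_split; apply: eq_bigr => i _; rewrite exprD. Qed.

Lemma monomial0 s : monomial (fun=> 0%N) s = 1.
Proof. by rewrite /monomial big1. Qed.

Lemma monomial_spin i s : monomial (fun j => (j == i : nat)) s = spin R s i.
Proof.
by rewrite /monomial (bigD1 i) //= eqxx big1 ?mulr1 // => j /negbTE ->.
Qed.

(** The sum factorizes over sites, and the factor at [i] is 2 or 0 according to the parity of
    [k i]. *)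
Lemma sum_monomial_ge0 k : 0 <= \sum_(s : config n) monomial k s.
Proof.
have -> : \sum_(s : config n) monomial k s =
    \prod_(i < n) \sum_(b : bool) (if b then 1 else -1) ^+ k i.
  by rewrite bigA_distr_bigA.
apply: prodr_ge0 => i _; rewrite big_bool /= expr1n -signr_odd.
by case: odd; rewrite ?expr0 ?expr1; lra.
Qed.

(* The functions with nonnegative Walsh coefficients. *)
Inductive cone : (config n -> R) -> Prop :=
| cone0 : cone (fun=> 0)
| cone_cons c k f : 0 <= c -> cone f -> cone (fun s => c * monomial k s + f s).

Lemma eq_cone f g : f =1 g -> cone f -> cone g.
Proof. by move=> /funext ->. Qed.

Lemma sum_cone_ge0 f : cone f -> 0 <= \sum_(s : config n) f s.
Proof.
elim=> [|c k {}f c0 _ IH]; first by rewrite big1.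
by rewrite big_split /= -mulr_sumr addr_ge0 // mulr_ge0 // sum_monomial_ge0.
Qed.

Lemma coneD f g : cone f -> cone g -> cone (fun s => f s + g s).
Proof.
move=> + cg; elim=> [|c k {}f c0 _ IH]; first by apply: eq_cone cg => s; rewrite add0r.
by apply: eq_cone (cone_cons c k _ c0 IH) => s; rewrite addrA.
Qed.

Lemma cone_monomial c k : 0 <= c -> cone (fun s => c * monomial k s).
Proof. by move=> c0; apply: eq_cone (cone_cons c k _ c0 cone0) => s; rewrite addr0. Qed.

Lemma coneM f g : cone f -> cone g -> cone (fun s => f s * g s).
Proof.
move=> + cg; elim=> [|c k {}f c0 _ IH].
  by apply: eq_cone cone0 => s; rewrite mul0r.
suff h : cone (fun s => c * monomial k s * g s).
  by apply: eq_cone (coneD _ _ h IH) => s; rewrite mulrDl.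
elim: cg {IH} => [|b l {}g b0 _ h]; first by apply: eq_cone cone0 => s; rewrite mulr0.
apply: eq_cone (cone_cons (c * b) (fun i => k i + l i)%N _ (mulr_ge0 c0 b0) h) => s.
by rewrite -monomialM; ring.
Qed.

Lemma cone_const c : 0 <= c -> cone (fun=> c).
Proof.
move=> c0; apply: eq_cone (cone_monomial c (fun=> 0%N) c0) => s.
by rewrite monomial0 mulr1.
Qed.

Lemma coneZ c f : 0 <= c -> cone f -> cone (fun s => c * f s).
Proof. by move=> c0; apply: coneM; apply: cone_const. Qed.

Lemma cone_spin i : cone (fun s => spin R s i).
Proof.
apply: eq_cone (cone_monomial 1 (fun j => (j == i : nat)) ler01) => s.
by rewrite mul1r monomial_spin.
Qed.

Lemma cone_sum (I : Type) (t : seq I) (P : pred I) (F : I -> config n -> R) :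
  (forall i, P i -> cone (F i)) -> cone (fun s => \sum_(i <- t | P i) F i s).
Proof.
move=> cF; elim: t => [|i t IH]; first by apply: eq_cone cone0 => s; rewrite big_nil.
case Pi: (P i); last by apply: eq_cone IH => s; rewrite big_cons Pi.
by apply: eq_cone (coneD _ _ (cF i Pi) IH) => s; rewrite big_cons Pi.
Qed.

Lemma cone_prod (I : Type) (t : seq I) (P : pred I) (F : I -> config n -> R) :
  (forall i, P i -> cone (F i)) -> cone (fun s => \prod_(i <- t | P i) F i s).
Proof.
move=> cF; elim: t => [|i t IH].
  by apply: eq_cone (cone_const 1 ler01) => s; rewrite big_nil.
case Pi: (P i); last by apply: eq_cone IH => s; rewrite big_cons Pi.
by apply: eq_cone (coneM _ _ (cF i Pi) IH) => s; rewrite big_cons Pi.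
Qed.

Lemma coneX f p : cone f -> cone (fun s => f s ^+ p).
Proof.
move=> cf; elim: p => [|p IH]; first exact: cone_const ler01.
by apply: eq_cone (coneM _ _ cf IH) => s; rewrite exprS.
Qed.

(** * Hyperbolic functions on the cone *)

Lemma sinh_le (c : R) : 0 <= c -> sinh c <= c * cosh c.
Proof.
move=> c0.
(* [g] is twice [x * cosh x - sinh x]; it vanishes at 0 and its derivative [2 * x * sinh x] is
   nonnegative for [x >= 0]. *)
pose g (x : R) := (x - 1) * expR x + (x + 1) * expR (- x).
have dg (x : R) : is_derive x (1 : R) g (x * (expR x - expR (- x))).
  apply: is_derive_eq; rewrite /GRing.scale /=; ring.
have [|x] := @MVT_segment R g (fun x => x * (expR x - expR (- x))) 0 c c0.
  by apply: derivable_within_continuous => x _; have [] := dg x.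
rewrite in_itv /= => /andP[x0 _]; rewrite /g oppr0 expR0.
have : 0 <= x * (expR x - expR (- x)) * (c - 0).
  by rewrite !mulr_ge0 ?subr0 // subr_ge0 ler_expR; lra.
rewrite /cosh /sinh; lra.
Qed.

(** A monomial squares to 1, so [cosh] of [c * monomial k] is constant and [sinh] of it is a
    multiple of the monomial. The addition formulas then build up sums, and they mix the three
    functions, hence the joint induction. *)
Lemma cone_hyperbolic u : cone u ->
  [/\ cone (fun s => cosh (u s)), cone (fun s => sinh (u s)) &
      cone (fun s => u s * cosh (u s) - sinh (u s))].
Proof.
elim=> [|c k {}u c0 cu [chu shu du]].
  split; first by apply: eq_cone (cone_const 1 ler01) => s; rewrite cosh0.
    by apply: eq_cone cone0 => s; rewrite sinh0.
  by apply: eq_cone cone0 => s; rewrite sinh0 mul0r subrr.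
have ch1 : cone (fun s => cosh (c * monomial k s)).
  apply: eq_cone (cone_const _ (cosh_ge0 c)) => s.
  by rewrite cosh_sign // monomial_sqr.
have sh1 : cone (fun s => sinh (c * monomial k s)).
  apply: eq_cone (cone_monomial _ k (sinh_ge0 _ c0)) => s.
  by rewrite sinh_sign // monomial_sqr.
have d1 : cone (fun s => c * monomial k s * cosh (c * monomial k s)
                       - sinh (c * monomial k s)).
  have h : 0 <= c * cosh c - sinh c by rewrite subr_ge0 sinh_le.
  apply: eq_cone (cone_monomial _ k h) => s.
  by rewrite cosh_sign ?sinh_sign ?monomial_sqr //; ring.
split.
- by apply: eq_cone (coneD _ _ (coneM _ _ ch1 chu) (coneM _ _ sh1 shu)) => s;
    rewrite coshD.
- by apply: eq_cone (coneD _ _ (coneM _ _ sh1 chu) (coneM _ _ ch1 shu)) => s;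
    rewrite sinhD.
- have cc := cone_cons c k _ c0 cu.
  (* With [D x = x * cosh x - sinh x], one has [D (x + y) = D x * cosh y + cosh x * D y + (x + y) *
     sinh x * sinh y]. *)
  apply: eq_cone (coneD _ _ (coneD _ _ (coneM _ _ d1 chu) (coneM _ _ ch1 du))
                   (coneM _ _ cc (coneM _ _ sh1 shu))) => s.
  by rewrite sinhD coshD; ring.
Qed.

Lemma cone_expR u : cone u -> cone (fun s => expR (u s)).
Proof.
case/cone_hyperbolic => ch sh _.
by apply: eq_cone (coneD _ _ ch sh) => s; rewrite expR_cosh_sinh.
Qed.

(** * Domination of Walsh coefficients and Ginibre's inequality *)

Definition cmul s r : config n := [ffun i => s i == r i].

Lemma spin_cmul s r i : spin R (cmul s r) i = spin R s i * spin R r i.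
Proof.
by rewrite /spin ffunE; case: (s i); case: (r i); rewrite /= ?mul1r ?mulr1 ?mulrNN ?mulr1.
Qed.

Lemma cmulK s : involutive (cmul s).
Proof. by move=> r; apply/ffunP => i; rewrite !ffunE; case: (s i); case: (r i). Qed.

(* Says that every Walsh coefficient of [g] is at least the absolute value of that of
   [f]: multiplying the argument by [r] changes the signs of the coefficients of [f]. *)
Definition dom f g := forall r,
  cone (fun s => g s - f (cmul s r)) /\ cone (fun s => g s + f (cmul s r)).

Lemma eq_dom f f' g g' : f =1 f' -> g =1 g' -> dom f g -> dom f' g'.
Proof. by move=> /funext -> /funext ->. Qed.

Lemma dom0 g : cone g -> dom (fun=> 0) g.
Proof. by move=> cg r; split; apply: eq_cone cg => s; rewrite ?subr0 ?addr0. Qed.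

Lemma domD f f' g g' : dom f g -> dom f' g' ->
  dom (fun s => f s + f' s) (fun s => g s + g' s).
Proof.
move=> h h' r; have [a b] := h r; have [a' b'] := h' r.
by split; [apply: eq_cone (coneD _ _ a a') => s | apply: eq_cone (coneD _ _ b b') => s];
  ring.
Qed.

(** Polarization: [2 (g g' - f f') = (g - f) (g' + f') + (g + f) (g' - f')], and similarly for the
    sum with equal signs in each product. *)
Lemma domM f f' g g' : dom f g -> dom f' g' ->
  dom (fun s => f s * f' s) (fun s => g s * g' s).
Proof.
move=> h h' r; have [a b] := h r; have [a' b'] := h' r.
have h2 : 0 <= 2^-1 :> R by [].
split.
  apply: eq_cone (coneZ _ _ h2 (coneD _ _ (coneM _ _ a b') (coneM _ _ b a'))) => s.
  by field.
apply: eq_cone (coneZ _ _ h2 (coneD _ _ (coneM _ _ a a') (coneM _ _ b b'))) => s.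
by field.
Qed.

Lemma dom_const (c c' : R) : `|c| <= c' -> dom (fun=> c) (fun=> c').
Proof. by rewrite ler_norml => /andP[? ?] r; split; apply: cone_const; lra. Qed.

Lemma dom_spin i : dom (fun s => spin R s i) (fun s => spin R s i).
Proof.
move=> r; split.
  apply: eq_cone (coneZ (1 - spin R r i) _ _ (cone_spin i)) => [s|].
    by rewrite spin_cmul; ring.
  by rewrite /spin; case: (r i); lra.
apply: eq_cone (coneZ (1 + spin R r i) _ _ (cone_spin i)) => [s|].
  by rewrite spin_cmul; ring.
by rewrite /spin; case: (r i); lra.
Qed.

Lemma dom_sum (I : Type) (t : seq I) (P : pred I) (F G : I -> config n -> R) :
  (forall i, P i -> dom (F i) (G i)) ->
  dom (fun s => \sum_(i <- t | P i) F i s) (fun s => \sum_(i <- t | P i) G i s).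
Proof.
move=> dF; elim: t => [|i t IH].
  by apply: eq_dom (dom0 _ cone0) => s; rewrite big_nil.
case Pi: (P i); last by apply: eq_dom IH => s; rewrite big_cons Pi.
by apply: eq_dom (domD _ _ _ _ (dF i Pi) IH) => s; rewrite big_cons Pi.
Qed.

Lemma dom_prod (I : Type) (t : seq I) (P : pred I) (F G : I -> config n -> R) :
  (forall i, P i -> dom (F i) (G i)) ->
  dom (fun s => \prod_(i <- t | P i) F i s) (fun s => \prod_(i <- t | P i) G i s).
Proof.
move=> dF; elim: t => [|i t IH].
  by apply: eq_dom (dom_const 1 1 _) => [s|s|]; rewrite ?big_nil ?normr1.
case Pi: (P i); last by apply: eq_dom IH => s; rewrite big_cons Pi.
by apply: eq_dom (domM _ _ _ _ (dF i Pi) IH) => s; rewrite big_cons Pi.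
Qed.

Lemma domX f g p : dom f g -> dom (fun s => f s ^+ p) (fun s => g s ^+ p).
Proof.
move=> h; elim: p => [|p IH].
  by apply: dom_const; rewrite normr1.
by apply: eq_dom (domM _ _ _ _ h IH) => s; rewrite exprS.
Qed.

(* Ginibre's duplication: in the variables (s, r) with t = s * r, the summand lies,
   for each fixed r, in the cone of functions of s. *)
Lemma ginibre h h' f g : dom h h' -> dom f g ->
  0 <= \sum_(s : config n) \sum_(t : config n)
         (g s - f t) * (expR (h' s) * expR (h t)).
Proof.
move=> dh df.
under eq_bigr => s _ do rewrite (reindex_inj (inv_inj (cmulK s))) /=.
rewrite exchange_big /=; apply: sumr_ge0 => r _; apply: sum_cone_ge0.
(* The difference half of [dom f g] handles the observable; the sum half of [dom h h'] handles the
   exponent. *)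
apply: coneM; first by case: (df r).
by apply: eq_cone (cone_expR _ (dh r).2) => s; rewrite expRD.
Qed.

End Cone.

(** * Gibbs measures and comparison of couplings *)

Section Gibbs.
Context {R : realType} {n : nat}.
Implicit Types (f g : config n -> R) (s : config n) (J : 'M[R]_n) (i : 'I_n).

Definition energy J s : R :=
  2^-1 * \sum_(i < n) \sum_(j < n) J i j * spin R s i * spin R s j.

Lemma gibbs_weight_gt0 J s : 0 < gibbs_weight J s.
Proof. exact: expR_gt0. Qed.

Lemma partition_fn_gt0 J : 0 < partition_fn J.
Proof.
rewrite /partition_fn (bigD1 [ffun=> true]) //=.
rewrite ltr_pwDl ?gibbs_weight_gt0 // sumr_ge0 // => s _.
exact/ltW/gibbs_weight_gt0.
Qed.

Lemma gibbs_ge0 J s : 0 <= gibbs J s.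
Proof. by rewrite divr_ge0 // ltW // (gibbs_weight_gt0, partition_fn_gt0). Qed.

Lemma sum_gibbs J : \sum_(s : config n) gibbs J s = 1.
Proof. by rewrite -mulr_suml divff // gt_eqF ?partition_fn_gt0. Qed.

Lemma gibbs_expE J f :
  gibbs_exp J f = (\sum_(s : config n) gibbs_weight J s * f s) / partition_fn J.
Proof. by rewrite mulr_suml; apply: eq_bigr => s _; rewrite mulrAC. Qed.

Lemma dom_energy J J' : (forall i j, `|J i j| <= J' i j) ->
  dom (energy J) (energy J').
Proof.
move=> JJ'; apply: domM; first by apply: dom_const; rewrite ger0_norm.
apply: dom_sum => i _; apply: dom_sum => j _.
by apply: domM (dom_spin j); apply: domM (dom_spin i); apply: dom_const.
Qed.

(** Clearing both partition functions turns the difference of expectations into a double sum over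
    two independent copies, one per coupling matrix, which is the sum in [ginibre]. *)
Lemma gibbs_exp_dom J J' f g : (forall i j, `|J i j| <= J' i j) -> dom f g ->
  gibbs_exp J f <= gibbs_exp J' g.
Proof.
move=> JJ' fg; rewrite !gibbs_expE ler_pdivrMr ?partition_fn_gt0 //.
rewrite mulrAC ler_pdivlMr ?partition_fn_gt0 // -subr_ge0.
have := ginibre _ _ _ _ (dom_energy _ _ JJ') fg.
congr (0 <= _); rewrite /partition_fn mulr_suml [X in _ - X]mulr_suml.
under [X in _ - X]eq_bigr do rewrite mulr_sumr.
rewrite [X in _ - X]exchange_big -sumrB; apply: eq_bigr => s _ /=.
rewrite mulr_sumr -sumrB; apply: eq_bigr => t _.
rewrite /gibbs_weight -!/(energy _ _); ring.
Qed.

(** * Spin flips and local fields *)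

Definition flip i s : config n := [ffun j => (j == i) (+) s j].

Lemma flipK i : involutive (flip i).
Proof. by move=> s; apply/ffunP => j; rewrite !ffunE addbA addbb. Qed.

Lemma spin_flip i s : spin R (flip i s) i = - spin R s i.
Proof. by rewrite /spin ffunE eqxx; case: (s i); rewrite //= opprK. Qed.

Lemma spin_flip_neq i j s : j != i -> spin R (flip i s) j = spin R s j.
Proof. by rewrite /spin ffunE => /negbTE ->. Qed.

Lemma sum_spin_flip i f : (forall s, f (flip i s) = f s) ->
  \sum_(s : config n) spin R s i * f s = 0.
Proof.
move=> fi; set S := LHS.
have : S = - S.
  rewrite {1}/S (reindex_inj (inv_inj (flipK i))) /= -sumrN.
  by apply: eq_bigr => s _; rewrite spin_flip fi mulNr.
lra.
Qed.

Definition local_field J i s : R := \sum_(j < n) J i j * spin R s j.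

Definition rest_energy J i s : R :=
  2^-1 * \sum_(a < n | a != i) \sum_(b < n | b != i) J a b * spin R s a * spin R s b.

Definition magnetization s : R := \sum_(i < n) spin R s i.

(** * Mean-field inequalities for ferromagnetic couplings *)

Section Ferromagnet.
Variable J : 'M[R]_n.
Hypotheses (J_sym : J^T = J) (J_diag : forall i, J i i = 0).
Hypothesis J_ge0 : forall i j, 0 <= J i j.

Let J_symE i j : J i j = J j i.
Proof. by rewrite -{1}J_sym mxE. Qed.

(** By symmetry, row [i] and column [i] each contribute the local field times the spin, which
    absorbs the factor 1/2. *)
Lemma energyE i s :
  energy J s = local_field J i s * spin R s i + rest_energy J i s.
Proof.
rewrite /energy /rest_energy (bigD1 i) //=.
have -> : \sum_(j < n) J i j * spin R s i * spin R s j
    = local_field J i s * spin R s i.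
  by rewrite mulr_suml; apply: eq_bigr => j _; rewrite mulrAC.
have -> : \sum_(a < n | a != i) \sum_(j < n) J a j * spin R s a * spin R s j
    = local_field J i s * spin R s i
      + \sum_(a < n | a != i) \sum_(b < n | b != i) J a b * spin R s a * spin R s b.
  under eq_bigr do rewrite (bigD1 i) //=.
  rewrite big_split /= -mulr_suml; congr (_ * _ + _).
  rewrite /local_field [RHS](bigD1 i) //= J_diag mul0r add0r.
  by apply: eq_bigr => j _; rewrite J_symE.
by field.
Qed.

Lemma local_field_flip i s : local_field J i (flip i s) = local_field J i s.
Proof.
apply: eq_bigr => j _; have [->|ji] := eqVneq j i; first by rewrite J_diag !mul0r.
by rewrite spin_flip_neq.
Qed.

Lemma rest_energy_flip i s : rest_energy J i (flip i s) = rest_energy J i s.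
Proof.
congr (_ * _); apply: eq_bigr => a ai; apply: eq_bigr => b bi.
by rewrite !spin_flip_neq.
Qed.

Lemma cone_local_field i : cone (local_field J i).
Proof. by apply: cone_sum => j _; apply: coneZ => //; exact: cone_spin. Qed.

(** The predicate lets one proof serve the full energy and the energy without site [i]. *)
Lemma cone_quadratic (P : pred 'I_n) :
  cone (fun s => 2^-1 * \sum_(a < n | P a) \sum_(b < n | P b)
                          J a b * spin R s a * spin R s b).
Proof.
apply: coneZ => //; apply: cone_sum => a _; apply: cone_sum => b _.
by apply: coneM; [apply: coneZ => //|]; exact: cone_spin.
Qed.

Lemma cone_magnetization : cone magnetization.
Proof. by apply: cone_sum => i _; exact: cone_spin. Qed.

Lemma gibbs_weight_cone_ge0 f : cone f ->
  0 <= \sum_(s : config n) gibbs_weight J s * f s.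
Proof.
move=> cf; apply: sum_cone_ge0; apply: coneM cf; apply: cone_expR.
exact: (cone_quadratic predT).
Qed.

(* Conditionally on the other spins, [spin i] has mean [tanh u] with [u] the local
   field; clearing the denominator [cosh u], the claim reduces to
   [u cosh u - sinh u] having nonnegative Taylor coefficients. *)
Lemma mean_field i g : cone g -> (forall s, g (flip i s) = g s) ->
  0 <= \sum_(s : config n)
         gibbs_weight J s * ((local_field J i s - spin R s i) * g s).
Proof.
move=> cg gi.
pose u := local_field J i; pose e s := expR (rest_energy J i s).
(* Expand the weight and separate by parity in [spin R s i]: the odd part sums to zero under the
   flip, leaving [u cosh u - sinh u]. *)
rewrite (eq_bigr (fun s => (u s * cosh (u s) - sinh (u s)) * (e s * g s) +
  spin R s i * ((u s * sinh (u s) - cosh (u s)) * (e s * g s)))); last first.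
  move=> s _; rewrite /gibbs_weight -/(energy J s) (energyE i) -/(u s).
  rewrite expRD -/(e s) expR_cosh_sinh cosh_sign ?sinh_sign ?spin_sqr //.
  have := spin_sqr s i; set v := spin R s i => v2.
  transitivity ((u s * cosh (u s) + (u s * sinh (u s) - cosh (u s)) * v
                 - v ^+ 2 * sinh (u s)) * (e s * g s)).
    by ring.
  by rewrite v2; ring.
rewrite big_split /= [X in _ + X]sum_spin_flip ?addr0; last first.
  by move=> s; rewrite /u /e local_field_flip rest_energy_flip gi.
have [_ _ cu] := cone_hyperbolic _ (cone_local_field i).
apply: sum_cone_ge0; apply: coneM => //; apply: coneM => //.
exact/cone_expR/cone_quadratic.
Qed.

(* Integration by parts: the [p]-term bounds the discrete derivative of
   [magnetization ^+ p] in the direction [i]. *)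
Lemma mean_field_magnetization i p g : cone g -> (forall s, g (flip i s) = g s) ->
  0 <= \sum_(s : config n)
         gibbs_weight J s * ((local_field J i s - spin R s i) * magnetization s ^+ p * g s
                             + p%:R * magnetization s ^+ p.-1 * g s).
Proof.
elim: p g => [|p IH] g cg gi.
  under eq_bigr do rewrite expr0 mulr1 mul0r mul0r addr0.
  exact: mean_field.
(* The induction hypothesis requires a flip-invariant factor, so only the part of the magnetization
   without spin [i] is moved into [g]. *)
pose g' s := (\sum_(j < n | j != i) spin R s j) * g s.
have cg' : cone g'.
  by apply: coneM => //; apply: cone_sum => j _; exact: cone_spin.
have gi' s : g' (flip i s) = g' s.
  by rewrite /g' gi; congr (_ * _); apply: eq_bigr => j ji; rewrite spin_flip_neq.
have MX q : cone (fun s => magnetization s ^+ q).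
  exact/coneX/cone_magnetization.
(* [h] restores the spin [i] removed in [g']; the remaining term [v ^+ 2 * Q * g s], with
   [v ^+ 2 = 1], raises the coefficient from [p] to [p.+1]. *)
pose h s := local_field J i s * (spin R s i * (magnetization s ^+ p * g s))
  + p%:R * (magnetization s ^+ p.-1 * (spin R s i * g s)).
have ch : cone h.
  apply: coneD; [apply: coneM; first exact: cone_local_field|apply: coneZ => //].
    by apply: coneM; [exact: cone_spin|exact: coneM].
  by apply: coneM => //; apply: coneM => //; exact: cone_spin.
have := addr_ge0 (IH g' cg' gi') (gibbs_weight_cone_ge0 _ ch).
rewrite -big_split; congr (0 <= _); apply: eq_bigr => s _ /=.
rewrite -mulrDr; congr (_ * _); rewrite /h /g'.
have -> : \sum_(j < n | j != i) spin R s j = magnetization s - spin R s i.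
  by rewrite /magnetization [X in _ = X - _](bigD1 i) //= addrAC subrr add0r.
(* For [p = 0] the truncated exponent [p.-1] is harmless, as both sides have the factor 0. *)
have pE : p%:R * magnetization s ^+ p = p%:R * magnetization s ^+ p.-1 * magnetization s.
  by case: (p) => [|q]; rewrite ?mul0r // -mulrA -exprSr.
have := spin_sqr s i; set v := spin R s i => v2.
rewrite -[p.+1%:R]natr1 [(_ + 1) * _]mulrDl mul1r pE exprS.
set M := magnetization s; set Q := M ^+ p; set P := M ^+ p.-1; set u := local_field _ _ _.
transitivity (u * Q * M * g s - v * M * Q * g s + v ^+ 2 * Q * g s + p%:R * P * M * g s).
  by ring.
by rewrite v2; ring.
Qed.

(** * Even moments of the magnetization *)

Variable alpha : R.
Hypothesis alpha_gt0 : 0 < alpha.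
Hypothesis J_row : forall i, \sum_(j < n) J i j <= 1 - alpha.

Lemma magnetization_step p :
  alpha * \sum_(s : config n) gibbs_weight J s * magnetization s ^+ p.+1 <=
  n%:R * p%:R * \sum_(s : config n) gibbs_weight J s * magnetization s ^+ p.-1.
Proof.
have h1 : 0 <= \sum_(i < n) \sum_(s : config n)
    gibbs_weight J s * ((local_field J i s - spin R s i) * magnetization s ^+ p * 1
                             + p%:R * magnetization s ^+ p.-1 * 1).
  apply: sumr_ge0 => i _.
  by apply: (mean_field_magnetization i p (fun=> 1)) => //; exact: cone_const.
(* By symmetry the local fields add up to the spins weighted by row sums; the gap to
   [(1 - alpha) * magnetization] has nonnegative coefficients. *)
have h2 : 0 <= \sum_(s : config n) gibbs_weight J s *
    ((\sum_(j < n) (1 - alpha - \sum_(k < n) J j k) * spin R s j) * magnetization s ^+ p).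
  apply: gibbs_weight_cone_ge0; apply: coneM.
    apply: cone_sum => j _; apply: coneZ; last exact: cone_spin.
    by rewrite subr_ge0.
  exact/coneX/cone_magnetization.
rewrite -subr_ge0; have := addr_ge0 h1 h2; congr (0 <= _).
rewrite exchange_big -big_split !mulr_sumr -sumrB /=; apply: eq_bigr => s _.
rewrite -mulr_sumr -mulrDr.
rewrite [RHS](_ : _ = gibbs_weight J s * (n%:R * p%:R * magnetization s ^+ p.-1
  - alpha * magnetization s ^+ p.+1)); last by ring.
congr (_ * _).
rewrite big_split /= -!mulr_suml sumr_const card_ord sumrB -/(magnetization s).
have -> : \sum_(j < n) (1 - alpha - \sum_(k < n) J j k) * spin R s j
    = (1 - alpha) * magnetization s - \sum_(i < n) local_field J i s.
  under eq_bigr do rewrite mulrBl.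
  rewrite sumrB -mulr_sumr; congr (_ - _); rewrite exchange_big /=.
  apply: eq_bigr => j _; rewrite mulr_suml.
  by apply: eq_bigr => k _; rewrite J_symE.
rewrite exprS -[_ *+ n]mulr_natl; ring.
Qed.

(** [N] stays fixed during the induction, so that each step costs the same factor: [2m + 1 <= 2N].
    It is set to [m] at the end. *)
Lemma magnetization_moment m N : (m <= N)%N ->
  \sum_(s : config n) gibbs_weight J s * magnetization s ^+ m.*2 <=
  (2 * N%:R * n%:R / alpha) ^+ m * partition_fn J.
Proof.
elim: m => [_|m IH mN].
  rewrite mul1r /partition_fn.
  by under eq_bigr do rewrite mulr1.
have := magnetization_step m.*2.+1.
rewrite -doubleS mulrC -ler_pdivlMr //= => /le_trans; apply.
rewrite mulrAC exprS -[leRHS]mulrA.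
apply: ler_pM.
- by rewrite divr_ge0 ?mulr_ge0 // ltW.
- apply: gibbs_weight_cone_ge0; exact/coneX/cone_magnetization.
- rewrite ler_pM2r ?invr_gt0 // mulrC ler_wpM2r // -natrM ler_nat mul2n.
  by rewrite -leq_double doubleS in mN; exact: ltnW.
- exact/IH/ltnW.
Qed.

Lemma gibbs_exp_magnetization m :
  gibbs_exp J (fun s => magnetization s ^+ m.*2) <= (2 * m%:R * n%:R / alpha) ^+ m.
Proof.
by rewrite gibbs_expE ler_pdivrMr ?partition_fn_gt0 // magnetization_moment.
Qed.

End Ferromagnet.

(** * Domination of the polynomial by a power of the magnetization *)

Lemma prod_spin_ffun d (I : {set 'I_n}) : #|I| = d ->
  exists2 phi : {ffun 'I_d -> 'I_n}, [set phi k | k : 'I_d] = I &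
    forall s, \prod_k spin R s (phi k) = \prod_(i in I) spin R s i.
Proof.
move=> <-; exists [ffun k => enum_val k].
  apply/setP => i; apply/imsetP/idP => [[k _ ->]|iI].
    by rewrite ffunE enum_valP.
  by exists (enum_rank_in iI i); rewrite // ffunE enum_rankK_in.
by move=> s; rewrite [RHS]big_enum_val; apply: eq_bigr => k _; rewrite ffunE.
Qed.

Lemma coef_sup_ge0 d (a : {set 'I_n} -> R) : 0 <= coef_sup d a.
Proof. by apply: bigmax_ge_id. Qed.

Lemma magnetizationX d s : magnetization s ^+ d =
  \sum_(I : {set 'I_n}) \sum_(phi : {ffun 'I_d -> 'I_n} | [set phi k | k : 'I_d] == I)
     \prod_k spin R s (phi k).
Proof.
rewrite -{1}[d]card_ord -prodr_const bigA_distr_bigA /=.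
exact: (partition_big (fun phi : {ffun 'I_d -> 'I_n} => [set phi k | k : 'I_d]) predT).
Qed.

(** Group the maps in the expansion of [magnetization s ^+ d] by image. A set of size [d] is the
    image of some enumeration, whose term dominates the monomial; all other terms lie in the
    cone. *)
Lemma hom_poly_dom d (a : {set 'I_n} -> R) :
  dom (hom_poly d a) (fun s => coef_sup d a * magnetization s ^+ d).
Proof.
(* Extension by zero, since the power also produces images with fewer than [d] elements. *)
pose b (I : {set 'I_n}) := if #|I| == d then a I else 0.
apply: (eq_dom (fun s => \sum_(I : {set 'I_n}) b I * \prod_(i in I) spin R s i)
  _ (fun s => \sum_(I : {set 'I_n}) coef_sup d a *
  \sum_(phi : {ffun 'I_d -> 'I_n} | [set phi k | k : 'I_d] == I)
     \prod_k spin R s (phi k))).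
- move=> s; rewrite /hom_poly [RHS]big_mkcond /=; apply: eq_bigr => I _.
  by rewrite /b; case: ifP; rewrite ?mul0r.
- by move=> s; rewrite magnetizationX mulr_sumr.
have cphi (P : pred {ffun 'I_d -> 'I_n}) :
    cone (fun s => coef_sup d a * \sum_(phi | P phi) \prod_k spin R s (phi k)).
  apply: coneZ; first exact: coef_sup_ge0.
  by apply: cone_sum => phi _; apply: cone_prod => k _; exact: cone_spin.
apply: dom_sum => I _; rewrite /b; case: ifP => [/eqP Id|_]; last first.
  by apply: eq_dom (dom0 _ (cphi _)) => s; rewrite ?mul0r.
have [phi phiI phiE] := prod_spin_ffun _ _ Id.
have da : dom (fun s => a I * \prod_(i in I) spin R s i)
              (fun s => coef_sup d a * \prod_k spin R s (phi k)).
  apply: domM.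
    by apply: dom_const; apply: le_bigmax_cond; rewrite Id.
  pose h s := \prod_k spin R s (phi k).
  apply: (eq_dom h _ h) => //.
  by apply: dom_prod => k _; exact: dom_spin.
pose Q (psi : {ffun 'I_d -> 'I_n}) := ([set psi k | k : 'I_d] == I) && (psi != phi).
apply: eq_dom (domD _ _ _ _ da (dom0 _ (cphi Q))) => s.
  by rewrite addr0.
by rewrite -mulrDr [in RHS](bigD1 phi) //= phiI.
Qed.

End Gibbs.

(** * Moments and tails of the polynomial *)

Section Concentration.
Context {R : realType} {n : nat}.
Implicit Types (f g : config n -> R) (J : 'M[R]_n) (a : {set 'I_n} -> R).

Lemma hom_poly_moment d J (alpha : R) a k :
  J^T = J -> (forall i, J i i = 0) -> 0 < alpha ->
  (forall i, \sum_(j < n) `|J i j| <= 1 - alpha) ->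
  gibbs_exp J (fun s => hom_poly d a s ^+ k.*2) <=
  coef_sup d a ^+ k.*2 * (2 * (d * k)%:R * n%:R / alpha) ^+ (d * k).
Proof.
move=> J_sym J_diag a0 J_row.
pose J' : 'M[R]_n := \matrix_(i, j) `|J i j|.
have JJ' i j : `|J i j| <= J' i j by rewrite mxE.
apply: le_trans (gibbs_exp_dom _ _ _ _ JJ' (domX _ _ k.*2 (hom_poly_dom d a))) _.
have -> : gibbs_exp J' (fun s => (coef_sup d a * magnetization s ^+ d) ^+ k.*2)
    = coef_sup d a ^+ k.*2 * gibbs_exp J' (fun s => magnetization s ^+ (d * k).*2).
  rewrite /gibbs_exp mulr_sumr; apply: eq_bigr => s _.
  by rewrite exprMn -exprM doubleMr mulrCA.
rewrite ler_wpM2l ?exprn_ge0 ?coef_sup_ge0 //.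
apply: gibbs_exp_magnetization => //.
- by apply/matrixP => i j; rewrite !mxE -[in LHS]J_sym mxE.
- by move=> i; rewrite mxE J_diag normr0.
- by move=> i j; rewrite mxE.
- by move=> i; under eq_bigr do rewrite mxE.
Qed.

Lemma ler_gibbs_exp J f g : (forall s, f s <= g s) -> gibbs_exp J f <= gibbs_exp J g.
Proof. by move=> fg; apply: ler_sum => s _; rewrite ler_wpM2l ?gibbs_ge0. Qed.

Lemma gibbs_exp_sqr_le J f : gibbs_exp J f ^+ 2 <= gibbs_exp J (fun s => f s ^+ 2).
Proof.
rewrite -subr_ge0; set m := gibbs_exp J f.
have : 0 <= \sum_(s : config n) gibbs J s * (f s - m) ^+ 2.
  by apply: sumr_ge0 => s _; rewrite mulr_ge0 ?gibbs_ge0 ?sqr_ge0.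
rewrite (eq_bigr (fun s => gibbs J s * f s ^+ 2 - 2 * m * (gibbs J s * f s)
                            + m ^+ 2 * gibbs J s)); last by move=> s _; ring.
rewrite big_split sumrB /= -!mulr_sumr sum_gibbs -!/(gibbs_exp J _) -/m.
by congr (0 <= _); ring.
Qed.

Lemma gibbs_prob_le1 J E : gibbs_prob J E <= 1.
Proof.
rewrite -(sum_gibbs J) [leRHS](bigID E) /= lerDl sumr_ge0 // => s _.
exact: gibbs_ge0.
Qed.

Lemma gibbs_markov J f (t : R) k : 0 < t ->
  gibbs_prob J (fun s => t <= `|f s|) <= gibbs_exp J (fun s => f s ^+ k.*2) / t ^+ k.*2.
Proof.
move=> t0; rewrite ler_pdivlMr ?exprn_gt0 // /gibbs_prob mulr_suml.
rewrite /gibbs_exp [leRHS](bigID (fun s => t <= `|f s|)) /=.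
rewrite -[leLHS]addr0; apply: lerD; last first.
  apply: sumr_ge0 => s _; rewrite mulr_ge0 ?gibbs_ge0 //.
  by rewrite exprn_even_ge0 // odd_double.
apply: ler_sum => s ts; rewrite ler_wpM2l ?gibbs_ge0 //.
rewrite -[leRHS]ger0_norm ?exprn_even_ge0 ?odd_double // normrX.
by rewrite lerXn2r // nnegrE // ltW.
Qed.

(** The difference is at most twice the larger of the two absolute values. *)
Lemma exprB_le (x y : R) k : (x - y) ^+ k.*2 <= 4 ^+ k * (x ^+ k.*2 + y ^+ k.*2).
Proof.
have le (z w : R) : `|w| <= `|z| -> (z - w) ^+ k.*2 <= 4 ^+ k * z ^+ k.*2.
  move=> wz; rewrite -!mul2n !exprM -exprMn.
  apply: lerXn2r; rewrite ?nnegrE ?sqr_ge0 //; first by rewrite mulr_ge0 ?sqr_ge0.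
  rewrite -[leLHS]real_normK ?num_real // -[z ^+ 2]real_normK ?num_real //.
  have : `|z - w| <= 2 * `|z| by have := ler_normB z w; lra.
  move=> h; have -> : 4 * `|z| ^+ 2 = (2 * `|z|) ^+ 2 by ring.
  by rewrite lerXn2r ?nnegrE ?mulr_ge0.
have ev (z : R) : 0 <= z ^+ k.*2 by rewrite exprn_even_ge0 ?odd_double.
rewrite mulrDr; have [yx|/ltW xy] := leP `|y| `|x|.
  by rewrite (le_trans (le _ _ yx)) // lerDl mulr_ge0 ?ev ?exprn_ge0.
rewrite -[x - y]opprB exprNn -signr_odd odd_double mul1r.
by rewrite (le_trans (le _ _ xy)) // lerDr mulr_ge0 ?ev ?exprn_ge0.
Qed.

Lemma hom_poly_central_moment d J (alpha : R) a k :
  (0 < d)%N -> (0 < k)%N ->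
  J^T = J -> (forall i, J i i = 0) -> 0 < alpha ->
  (forall i, \sum_(j < n) `|J i j| <= 1 - alpha) ->
  gibbs_exp J (fun s => (hom_poly d a s - gibbs_exp J (hom_poly d a)) ^+ k.*2) <=
  2 * coef_sup d a ^+ k.*2 * (8 * (d * k)%:R * n%:R / alpha) ^+ (d * k).
Proof.
move=> d0 k0 J_sym J_diag alpha0 J_row; set m := gibbs_exp J (hom_poly d a).
set B := coef_sup d a ^+ k.*2 * (2 * (d * k)%:R * n%:R / alpha) ^+ (d * k).
(* The mean is controlled by the second moment, raised to the power [k]; then [d] is enlarged to
   [d * k] in the base. *)
have mB : m ^+ k.*2 <= B.
  have := hom_poly_moment d J alpha a 1 J_sym J_diag alpha0 J_row.
  rewrite muln1 => /(le_trans (gibbs_exp_sqr_le J _)) h.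
  rewrite -mul2n exprM.
  apply: (@le_trans _ _ ((coef_sup d a ^+ 2 * (2 * d%:R * n%:R / alpha) ^+ d) ^+ k)).
    by apply: lerXn2r; rewrite ?nnegrE ?sqr_ge0 //; apply: le_trans (sqr_ge0 m) h.
  rewrite exprMn -!exprM /B mul2n ler_wpM2l ?exprn_ge0 ?coef_sup_ge0 //.
  have ge0 (e : nat) : 0 <= 2 * e%:R * n%:R / alpha.
    by rewrite divr_ge0 ?mulr_ge0 // ltW.
  apply: lerXn2r; rewrite ?nnegrE ?ge0 // ler_pM2r ?invr_gt0 //.
  by rewrite ler_wpM2r // ler_wpM2l // ler_nat leq_pmulr.
apply: (@le_trans _ _ (4 ^+ k * (B + B))).
  apply: le_trans (ler_gibbs_exp _ _ _ (fun s => exprB_le _ m k)) _.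
  have -> : gibbs_exp J (fun s => 4 ^+ k * (hom_poly d a s ^+ k.*2 + m ^+ k.*2))
      = 4 ^+ k * (gibbs_exp J (fun s => hom_poly d a s ^+ k.*2) + m ^+ k.*2).
    rewrite /gibbs_exp -[X in _ * (_ + X)]mul1r -(sum_gibbs J) mulr_suml -big_split.
    by rewrite mulr_sumr; apply: eq_bigr => s _ /=; ring.
  by rewrite ler_wpM2l ?exprn_ge0 // lerD // hom_poly_moment.
(* The 8 is 2 times 4: since [d >= 1], the factor [4 ^+ k] is at most [4 ^+ (d * k)] and goes into
   the base. *)
have -> : 8 * (d * k)%:R * n%:R / alpha = 4 * (2 * (d * k)%:R * n%:R / alpha).
  by ring.
rewrite [in leRHS]exprMn; set T := (_ / alpha) ^+ _ in B mB *.
have -> : 4 ^+ k * (B + B) = 4 ^+ k * (2 * coef_sup d a ^+ k.*2 * T).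
  by rewrite /B; ring.
have -> : 2 * coef_sup d a ^+ k.*2 * (4 ^+ (d * k) * T)
  = 4 ^+ (d * k) * (2 * coef_sup d a ^+ k.*2 * T) by ring.
rewrite ler_wpM2r //.
  rewrite !mulr_ge0 ?exprn_ge0 ?coef_sup_ge0 // ?divr_ge0 ?mulr_ge0 ?ler0n //.
  exact: ltW.
by rewrite ler_weXn2l ?leq_pmull // ler1n.
Qed.

End Concentration.

(* [z] is chosen so that the hypothesis gives [P <= 2 exp (- d k)] for [k <= z]. *)
Lemma powR_tail (R : realType) (d : nat) (alpha x P : R) :
  (0 < d)%N -> 0 < alpha -> 0 < x -> P <= 1 ->
  (forall k, (0 < k)%N ->
     P <= 2 * (8 * (d * k)%:R / (alpha * x)) ^+ (d * k)) ->
  P <= 2 * expR (- (x / (32 * d%:R * expR 1 / alpha))).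
Proof.
move=> d0 a0 x0 P1 Pk.
have dR : 1 <= d%:R :> R by rewrite ler1n.
have e0 := expR_gt0 (1 : R).
pose z := x * alpha / (8 * d%:R * expR 1).
have z0 : 0 < z by rewrite divr_gt0 ?mulr_gt0 ?ltr0n.
have -> : x / (32 * d%:R * expR 1 / alpha) = z / 4.
  by rewrite /z; field; rewrite !gt_eqF ?ltr0n.
(* For [z < 2] the bound is trivial: [2 * expR (- (z / 4)) >= 2 * (1 - z / 4) > 1]. *)
have [z2|z2] := ltP z 2.
  have := expR_ge1Dx (- (z / 4)); lra.
have := truncn_itv (ltW z0); set k := Num.truncn z => /andP[kz zk].
have k0 : (0 < k)%N by rewrite -(ltr0n R); move: zk; rewrite -natr1; lra.
apply: le_trans (Pk k k0) _; rewrite ler_pM2l //.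
apply: (@le_trans _ _ (expR (- 1) ^+ (d * k))).
  have ax : 0 < alpha * x by rewrite mulr_gt0.
  apply: lerXn2r; rewrite ?nnegrE ?expR_ge0 //.
    by rewrite divr_ge0 ?mulr_ge0 // ltW.
  rewrite expRN ler_pdivrMr // ler_pdivlMl //.
  have -> : alpha * x = 8 * d%:R * expR 1 * z.
    by rewrite /z; field; rewrite !gt_eqF ?ltr0n.
  rewrite natrM (_ : expR 1 * _ = 8 * d%:R * expR 1 * k%:R); last by ring.
  by rewrite ler_wpM2l // !mulr_ge0 ?ler0n // ltW.
rewrite -expRM_natl ler_expR mulrN1 lerN2.
(* Rounding down costs at most 1, and [z - 1 >= z / 4] for [z >= 2]; this 4 turns the 8 in [z] into
   32. *)
apply: (@le_trans _ _ k%:R); last by rewrite ler_nat leq_pmull.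
by move: zk; rewrite -natr1; lra.
Qed.


Theorem theorem1p3 (R : realType) (d : nat) (alpha : R) :
  (0 < d)%N -> 0 < alpha -> alpha <= 1 ->
  exists c : R, 0 < c /\
  forall (n : nat) (J : 'M[R]_n),
    J^T = J ->
    (forall i, J i i = 0) ->
    (forall i, \sum_(j < n) `|J i j| <= 1 - alpha) ->
    forall (a : {set 'I_n} -> R) (t : R), 0 < t ->
      gibbs_prob J (fun s => `|hom_poly d a s - gibbs_exp J (hom_poly d a)| >= t)
      <= 2 * expR (- (t `^ (2 / d%:R)
                      / (c * n%:R * coef_sup d a `^ (2 / d%:R)))).
Proof.
move=> d0 alpha0 _; have dR : d%:R != 0 :> R by rewrite pnatr_eq0 -lt0n.
exists (32 * d%:R * expR 1 / alpha); split.
  by rewrite divr_gt0 ?mulr_gt0 ?expR_gt0 ?ltr0n.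
move=> n J J_sym J_diag J_row a t t0.
set P := gibbs_prob J _; set p := coef_sup d a; set c := 32 * _ * _ / _.
have P1 : P <= 1 by exact: gibbs_prob_le1.
(* When [n] or the coefficient norm vanishes, division by zero yields 0 and the right-hand side is
   2. *)
have [np0|np0] := eqVneq (n%:R * p `^ (2 / d%:R)) 0.
  by rewrite -mulrA np0 mulr0 invr0 mulr0 oppr0 expR0; lra.
have np : 0 < n%:R * p `^ (2 / d%:R).
  by rewrite lt_neqAle eq_sym np0 mulr_ge0 ?powR_ge0.
have -> : t `^ (2 / d%:R) / (c * n%:R * p `^ (2 / d%:R))
    = t `^ (2 / d%:R) / (n%:R * p `^ (2 / d%:R)) / c.
  by rewrite -[c * _ * _]mulrA invfM [c^-1 * _]mulrC mulrA.
apply: powR_tail => // [|k k0]; first by rewrite divr_gt0 ?powR_gt0.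
have p0 : 0 <= p by exact: coef_sup_ge0.
(* The exponent [d * k] clears the root [2 / d], matching the Markov bound with power [2k]. *)
have powE y : 0 <= y -> (y `^ (2 / d%:R)) ^+ (d * k) = y ^+ k.*2 :> R.
  move=> y0; rewrite -powR_mulrn ?powR_ge0 // -powRrM natrM mulrA divfK //.
  by rewrite -natrM powR_mulrn // mul2n.
apply: le_trans (gibbs_markov _ _ _ k t0) _.
have := hom_poly_central_moment d J alpha a k d0 k0 J_sym J_diag alpha0 J_row.
rewrite ler_pdivrMr ?exprn_gt0 // => /le_trans; apply.
rewrite -(powE t) ?(ltW t0) // -(powE p) // -[leLHS]mulrA -[leRHS]mulrA.
rewrite ler_pM2l // -!exprMn le_eqVlt; apply/orP; left; apply/eqP; congr (_ ^+ _).
field.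
by move: np0; rewrite mulf_eq0 negb_or => /andP[-> ->]; rewrite !gt_eqF ?powR_gt0.
Qed.
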